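(* Let $Q$ be a finite quiver without cycles, let $\mathfrak{n}_Q$ be the (finite-dimensional nilpotent) real Lie algebra obtained by $Q$, and let $N_Q$ be the simply-connected Lie group with Lie algebra $\mathfrak{n}_Q$. Then $N_Q$ admits a left-invariant Riemannian metric $g$ which is a Ricci soliton.
   Context: A quiver $Q=(V,E,s,t)$ consists of two sets $V$ (vertices), $E$ (arrows) and two maps $s,t:E\to V$ (source, target). It is finite if $V$ and $E$ are finite. A path of length $m\ge 1$ is a sequence $\alpha_1\alpha_2\cdots\alpha_m$ with $\alpha_i\in E$ and $t(\alpha_i)=s(\alpha_{i+1})$ for $i=1,\dots,m-1$; its source is $s(\alpha_1)$ and its target is $t(\alpha_m)$. (Vertices are not counted as paths.) A cycle is a path whose source and target coincide. $\mathrm{Path}(Q)$ is the set of all paths. The Lie algebra obtained by $Q$ is the real vector space $\mathfrak{n}_Q$ with basis $\mathrm{Path}(Q)$ and bracket $[x,y]=x\cdot y-y\cdot x$, where $\cdot$ is the bilinear product given on paths by $x\cdot y=xy$ (concatenation) if $xy$ is a path, and $x\cdot y=0$ otherwise. A Riemannian metric $g$ on a manifold $M$ is called a Ricci soliton if there exist $c\in\mathbb{R}$ and a vector field $X$ on $M$ such that $\mathrm{ric}_g=c\cdot g+\mathcal{L}_Xg$, where $\mathrm{ric}_g$ is the Ricci curvature tensor and $\mathcal{L}_X$ the Lie derivative along $X$. *)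

(* Defs.v *)
From HB Require Import structures.
From mathcomp Require Import all_boot all_order all_algebra.
From mathcomp Require Import boolp classical_sets functions reals topology normedtype derive.

Set Implicit Arguments.
Unset Strict Implicit.
Unset Printing Implicit Defensive.

Import Order.TTheory GRing.Theory Num.Theory.
Import numFieldNormedType.Exports.

Local Open Scope ring_scope.

(* Every simply connected nilpotent Lie group is diffeomorphic to R^n, so tensor
   fields are given by their components in one global chart. *)
Section Geometry.
Context {R : realType} {n : nat}.
Implicit Types (f : 'rV[R]_n -> R) (g : 'rV[R]_n -> 'M[R]_n)
  (X Y : 'rV[R]_n -> 'rV[R]_n) (x u v : 'rV[R]_n) (i j k l : 'I_n).

Definition basis_vec i : 'rV[R]_n := delta_mx 0 i.

Definition partial i f : 'rV[R]_n -> R := fun x => 'D_(basis_vec i) f x.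

Fixpoint Ck (m : nat) f : Prop :=
  match m with
  | 0%N => continuous f
  | m'.+1 => continuous f /\
      forall i, (forall x, derivable f x (basis_vec i)) /\ Ck m' (partial i f)
  end.

Definition smooth f : Prop := forall m, Ck m f.

Definition metric_at g x u v : R := (u *m g x *m v^T) 0 0.

Definition riemannian_metric g : Prop :=
  [/\ forall i j, smooth (fun x => g x i j),
      forall x u v, metric_at g x u v = metric_at g x v u &
      forall x u, u != 0 -> 0 < metric_at g x u u].

Definition smooth_vector_field X : Prop := forall i, smooth (fun x => X x 0 i).

(* [christoffel g k i j] is the component Gamma^k_{ij} of the Levi-Civita
   connection. *)
Definition christoffel g k i j : 'rV[R]_n -> R := fun x =>
  2^-1 * \sum_l invmx (g x) k l *
    (partial i (fun y => g y j l) x + partial j (fun y => g y i l) x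
     - partial l (fun y => g y i j) x).

(* Components ric_{jk} = R^i_{ijk}, with the sign for which round spheres have
   positive Ricci curvature. *)
Definition ricci g x : 'M[R]_n := \matrix_(j, k) \sum_i
  (partial i (christoffel g i j k) x - partial j (christoffel g i i k) x
   + \sum_l (christoffel g i i l x * christoffel g l j k x
             - christoffel g i j l x * christoffel g l i k x)).

Definition lie_derivative X g x : 'M[R]_n := \matrix_(i, j) \sum_k
  (X x 0 k * partial k (fun y => g y i j) x
   + g x k j * partial i (fun y => X y 0 k) x
   + g x i k * partial j (fun y => X y 0 k) x).

Definition ricci_soliton g : Prop :=
  exists (c : R) (X : 'rV[R]_n -> 'rV[R]_n), smooth_vector_field X /\
    forall x, ricci g x = c *: g x + lie_derivative X g x.

Implicit Type mul : 'rV[R]_n -> 'rV[R]_n -> 'rV[R]_n.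

Definition left_invariant_metric mul g : Prop := forall a x u v,
  metric_at g (mul a x) ('d (mul a) x u) ('d (mul a) x v) = metric_at g x u v.

Definition left_invariant_field mul X : Prop :=
  forall a x, 'd (mul a) x (X x) = X (mul a x).

Definition vector_field_bracket X Y : 'rV[R]_n -> 'rV[R]_n := fun x =>
  'd Y x (X x) - 'd X x (Y x).

End Geometry.

Record finite_quiver := FiniteQuiver {
  vertex : finType;
  arrow : finType;
  source : arrow -> vertex;
  target : arrow -> vertex }.

Section Paths.
Variable Q : finite_quiver.

Definition is_path (p : seq (arrow Q)) : bool :=
  (p != [::]) && sorted (fun a b => target a == source b) p.

Definition is_cycle (p : seq (arrow Q)) : bool :=
  if p is a :: q then is_path p && (source a == target (last a q)) else false.

Definition acyclic : Prop := forall p : seq (arrow Q), ~~ is_cycle p.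

(* Without cycles no path uses an arrow twice, so the bound on the length, which
   makes this a finite type, is harmless: see [path_size_le]. *)
Definition path_bseq (p : #|arrow Q|.-bseq (arrow Q)) : bool := is_path p.

Definition Path : finType := {p : #|arrow Q|.-bseq (arrow Q) | path_bseq p}.

Definition npath : nat := #|Path|.

Definition nth_path (i : 'I_npath) : seq (arrow Q) :=
  bseqval (val (enum_val i : Path)).

Lemma path_size_le (p : seq (arrow Q)) :
  acyclic -> is_path p -> (size p <= #|arrow Q|)%N.
Proof.
move=> acQ pP; rewrite -(card_uniqP _) ?max_card //.
apply/negPn/negP => nu; move: pP.
have [a [s1 [s2 [s3 ->]]]] : exists a s1 s2 s3, p = s1 ++ a :: s2 ++ a :: s3.
  elim: p nu => //= b p IH; case: (boolP (b \in p)) => [bp _|_ /= /IH].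
    by case/splitPr: bp => q1 q2; exists b, [::], q1, q2.
  by move=> [a [s1 [s2 [s3 ->]]]]; exists a, (b :: s1), s2, s3.
case/andP=> _ srt.
have {}srt : path (fun a b => target a == source b) a (rcons s2 a).
  have : sorted (fun a b => target a == source b) (a :: s2 ++ a :: s3).
    by case: s1 srt => [//|b s1] /=; rewrite cat_path => /andP[_ /=] /andP[].
  by rewrite /= -cat_rcons cat_path => /andP[].
move: srt; rewrite rcons_path => /andP[srt /eqP e].
by have /negP := acQ (a :: s2); apply; rewrite /is_cycle /is_path /= srt e eqxx.
Qed.

Lemma nth_path_inj : injective nth_path.
Proof. by move=> i j /val_inj/val_inj/enum_val_inj. Qed.

Lemma nth_pathP (i : 'I_npath) : is_path (nth_path i).
Proof. exact: (valP (enum_val i : Path)). Qed.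

Lemma is_pathP (p : seq (arrow Q)) :
  acyclic -> is_path p -> exists i, nth_path i = p.
Proof.
move=> acQ pP; have sp := path_size_le acQ pP.
pose q : Path := exist (fun p => path_bseq p) (Bseq sp) pP.
by exists (enum_rank q); rewrite /nth_path enum_rankK.
Qed.

End Paths.

Section LieGroup.
Variables (R : realType) (Q : finite_quiver).

(* The real vector space with basis Path(Q), in coordinates. *)
Local Notation nQ := 'rV[R]_(npath Q).
Implicit Types x y z u v : nQ.

(* The basis vector of [p] if [p] is a path, and 0 otherwise. *)
Definition path_vec (p : seq (arrow Q)) : nQ :=
  \row_k (nth_path k == p)%:R.

Definition path_mul x y : nQ :=
  \sum_i \sum_j (x 0 i * y 0 j) *: path_vec (nth_path i ++ nth_path j).

Definition path_bracket x y : nQ := path_mul x y - path_mul y x.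

(* [path_mul] is associative and nilpotent, so 1 + n_Q is a group inside the
   unital algebra R + n_Q.  In the global chart 1 + x |-> x its product is the
   polynomial map x + y + x y, and inversion is polynomial too.  This Lie group
   is simply connected, being diffeomorphic to n_Q, and its Lie algebra is
   (n_Q, [path_bracket]) by [NQ_lie_algebra]; these two properties characterize
   N_Q up to isomorphism. *)
Definition NQ_mul x y : nQ := x + y + path_mul x y.

Lemma path_mulE x y k : path_mul x y 0 k =
  \sum_i \sum_j x 0 i * y 0 j * (nth_path k == nth_path i ++ nth_path j)%:R.
Proof.
rewrite /path_mul summxE; apply: eq_bigr => i _; rewrite summxE.
by apply: eq_bigr => j _; rewrite !mxE.
Qed.

Lemma path_mulDl x y z : path_mul (x + y) z = path_mul x z + path_mul y z.
Proof.
rewrite /path_mul -big_split; apply: eq_bigr => i _ /=.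
by rewrite -big_split; apply: eq_bigr => j _; rewrite mxE mulrDl scalerDl.
Qed.

Lemma path_mulDr x y z : path_mul x (y + z) = path_mul x y + path_mul x z.
Proof.
rewrite /path_mul -big_split; apply: eq_bigr => i _ /=.
by rewrite -big_split; apply: eq_bigr => j _; rewrite mxE mulrDr scalerDl.
Qed.

Lemma path_mulZl (c : R) x y : path_mul (c *: x) y = c *: path_mul x y.
Proof.
rewrite /path_mul scaler_sumr; apply: eq_bigr => i _.
by rewrite scaler_sumr; apply: eq_bigr => j _; rewrite mxE -mulrA scalerA.
Qed.

Lemma path_mulZr (c : R) x y : path_mul x (c *: y) = c *: path_mul x y.
Proof.
rewrite /path_mul scaler_sumr; apply: eq_bigr => i _.
by rewrite scaler_sumr; apply: eq_bigr => j _; rewrite mxE mulrCA scalerA.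
Qed.

Lemma path_mul0x x : path_mul 0 x = 0.
Proof. by have := path_mulZl 0 0 x; rewrite !scale0r. Qed.

Lemma path_mulx0 x : path_mul x 0 = 0.
Proof. by have := path_mulZr 0 x 0; rewrite !scale0r. Qed.

Lemma path_mulA x y z : acyclic Q ->
  path_mul x (path_mul y z) = path_mul (path_mul x y) z.
Proof.
move=> acQ; apply/rowP => k; rewrite !path_mulE.
pose T i j l : R := x 0 i * y 0 j * z 0 l *
  (nth_path k == nth_path i ++ nth_path j ++ nth_path l)%:R.
transitivity (\sum_i \sum_j \sum_l T i j l).
  apply: eq_bigr => i _.
  under eq_bigr => m _ do rewrite path_mulE mulr_sumr mulr_suml.
  rewrite exchange_big; apply: eq_bigr => j _ /=.
  under eq_bigr => m _ do rewrite mulr_sumr mulr_suml.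
  rewrite exchange_big; apply: eq_bigr => l _ /=; rewrite /T.
  case: eqP => [e|ne]; last first.
    rewrite mulr0 big1 // => m _; case: eqP => [->|]; last by rewrite !(mulr0,mul0r).
    by case: eqP => // _; rewrite mulr0.
  have [m em] : exists m, nth_path m = nth_path j ++ nth_path l.
    apply: is_pathP => //; have := nth_pathP k; have := nth_pathP j.
    rewrite e /is_path => /andP[+ _] /andP[_].
    case: (nth_path j) => //= b s _.
    by case: (nth_path i) => //= c s'; rewrite cat_path => /andP[_ /=] /andP[].
  rewrite (bigD1 m) //= em eqxx -e eqxx big1 ?addr0 => [|m' ne'].
    by rewrite !mulr1 !mulrA.
  case: eqP => [e'|]; last by rewrite !(mulr0,mul0r).
  by case/eqP: ne'; apply: nth_path_inj; rewrite em.
rewrite [RHS]exchange_big /=.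
under eq_bigr do rewrite exchange_big.
rewrite exchange_big; apply: eq_bigr => l _ /=.
under [RHS]eq_bigr => m _ do rewrite path_mulE !mulr_suml.
rewrite [RHS]exchange_big /=; apply: eq_bigr => i _.
under [RHS]eq_bigr => m _ do rewrite !mulr_suml.
rewrite [RHS]exchange_big /=; apply: eq_bigr => j _; rewrite /T catA.
case: eqP => [e|ne]; last first.
  rewrite mulr0 big1 // => m _; case: eqP => [e1|]; last by rewrite !(mulr0,mul0r).
  by case: eqP => [e2|]; [case: ne; rewrite e2 e1|rewrite mulr0].
have [m em] : exists m, nth_path m = nth_path i ++ nth_path j.
  apply: is_pathP => //; have := nth_pathP k; have := nth_pathP i.
  rewrite e /is_path => /andP[+ _] /andP[_].
  by case: (nth_path i) => //= b s _; rewrite cat_path => /andP[].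
rewrite (bigD1 m) //= em eqxx -e eqxx big1 ?addr0 => [|m' ne'].
  by rewrite !mulr1 // mulrAC.
case: eqP => [e'|]; last by rewrite !(mulr0,mul0r).
by case/eqP: ne'; apply: nth_path_inj; rewrite em.
Qed.

Lemma NQ_mulA x y z : acyclic Q ->
  NQ_mul x (NQ_mul y z) = NQ_mul (NQ_mul x y) z.
Proof.
move=> acQ; rewrite /NQ_mul !(path_mulDl, path_mulDr) path_mulA // !addrA.
by rewrite [LHS](ACl (1*2*5*3*6*4*7)).
Qed.

Lemma NQ_mul0x x : NQ_mul 0 x = x.
Proof. by rewrite /NQ_mul path_mul0x add0r addr0. Qed.

Lemma NQ_mulx0 x : NQ_mul x 0 = x.
Proof. by rewrite /NQ_mul path_mulx0 !addr0. Qed.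

Lemma NQ_mul_inv x : exists y, NQ_mul x y = 0.
Proof.
pose M : 'M[R]_(npath Q) := \matrix_i (delta_mx 0 i + path_mul x (delta_mx 0 i)).
have ME y : y *m M = y + path_mul x y.
  rewrite mulmx_sum_row [in RHS](row_sum_delta y).
  rewrite (big_morph _ (path_mulDr x) (path_mulx0 x)) -big_split /=.
  by apply: eq_bigr => i _; rewrite rowK path_mulZr scalerDr.
have Minj y : y *m M = 0 -> y = 0.
  rewrite ME => /eqP; rewrite addr_eq0 => /eqP y0; apply/rowP => k; rewrite [RHS]mxE.
  have [m] := ubnP (size (nth_path k)); elim: m k => // m IH k km.
  rewrite y0 mxE path_mulE big1 ?oppr0 // => i _; rewrite big1 // => j _.
  case: eqP => [e|]; last by rewrite mulr0.
  rewrite IH ?mulr0 ?mul0r //; move: km; rewrite e size_cat ltnS => km.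
  apply: leq_trans km; rewrite -add1n leq_add2r lt0n size_eq0.
  by case/andP: (nth_pathP i).
have Mu : M \in unitmx.
  rewrite -row_free_unit -kermx_eq0; apply/eqP/row_matrixP => i.
  by rewrite row0; apply: Minj; rewrite -row_mul mulmx_ker row0.
exists (- x *m invmx M).
by rewrite /NQ_mul -addrA -ME mulmxKV // addrN.
Qed.

Lemma diff_affine (c : nQ) (f : nQ -> nQ) : linear f ->
  forall x h, 'd (fun y => c + f y) x h = f h.
Proof.
move=> lf x h.
have [F FE] : exists F : {linear nQ -> nQ}, f = F :> (nQ -> nQ).
  pose F : {linear nQ -> nQ} := HB.pack f (GRing.isLinear.Build _ _ _ _ f lf).
  by exists F.
rewrite {}FE => {f lf}.
have FE : (F : nQ -> nQ) = \sum_j (fun y : nQ => y 0 j *: F (delta_mx 0 j)).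
  apply/funext => y; rewrite [in LHS](row_sum_delta y) linear_sum fct_sumE.
  by apply: eq_bigr => j _; rewrite linearZ.
have dF y : differentiable F y.
  rewrite FE; apply: differentiable_sum => j; apply: differentiableZl.
  exact: differentiable_coord.
have cF : continuous F by move=> y; exact: differentiable_continuous.
have isF : is_diff x F F by split; [exact: dF | exact: diff_lin].
have E := diff_val (is_diff_def := is_diffD (is_diff_cst c x) isF).
by have := congr1 (fun k : nQ -> nQ => k h) E; rewrite add0r.
Qed.

(* The vector fields [fun x => u + path_mul x u] are the left-invariant ones,
   and u |-> [fun x => u + path_mul x u] identifies n_Q with the Lie algebra of
   (R^n, [NQ_mul]). *)
Lemma NQ_lie_algebra : acyclic Q ->
  (forall X, left_invariant_field NQ_mul X <->
             exists u, X = fun x => u + path_mul x u) /\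
  (forall u v, vector_field_bracket (fun x => u + path_mul x u)
                                    (fun x => v + path_mul x v) =
               fun x => path_bracket u v + path_mul x (path_bracket u v)).
Proof.
move=> acQ.
have dL a x h : 'd (NQ_mul a) x h = h + path_mul a h.
  have -> : NQ_mul a = fun y => a + (y + path_mul a y).
    by apply/funext => y; rewrite /NQ_mul addrA.
  rewrite (@diff_affine a (fun y => y + path_mul a y)) //.
  by move=> t y z; rewrite path_mulDr path_mulZr scalerDr addrACA.
have dX u x h : 'd (fun x => u + path_mul x u) x h = path_mul h u.
  rewrite (@diff_affine u (fun y => path_mul y u)) //.
  by move=> t y z; rewrite path_mulDl path_mulZl.
split=> [X|u v].
  split=> [lX|[u ->] a x].
    exists (X 0); apply/funext => x.
    by rewrite -(dL x 0) lX NQ_mulx0.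
  rewrite dL /NQ_mul !path_mulDl path_mulDr path_mulA // !addrA.
  by rewrite [LHS](ACl (1*3*2*4)).
apply/funext => x.
transitivity (path_mul (u + path_mul x u) v - path_mul (v + path_mul x v) u).
  by congr (_ - _); exact: dX.
rewrite /path_bracket.
rewrite !path_mulDl path_mulDr -!(path_mulA _ _ _ acQ).
have -> : path_mul x (- path_mul v u) = - path_mul x (path_mul v u).
  by rewrite -scaleN1r path_mulZr scaleN1r.
by rewrite opprD addrACA.
Qed.

End LieGroup.

(* Main.v *)
From HB Require Import structures.
Require Import Defs.
From mathcomp Require Import all_boot all_order all_algebra.
From mathcomp Require Import boolp classical_sets functions reals topology normedtype derive.
From mathcomp Require Import ring lra.

(* Take the paths as an orthogonal basis, with |p|^2 the product over the interior
   vertices v of p of a(v) = 1 / (1 + out(v) + in(v)), where out(v) and in(v)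
   count the paths starting and ending at v.  As |pq|^2 = a(v) |p|^2 |q|^2 for a path
   pq with middle vertex v, the Ricci operator at the unit is diagonal with eigenvalues
     ric(p) = (sum_{v interior to p} a(v) - out(t(p)) a(t(p)) - in(s(p)) a(s(p))) / 2,
   and ric(pq) - ric(p) - ric(q) = a(v) (1 + out(v) + in(v)) / 2 = 1/2.  Hence
   ric = -1/2 + D, where D is a derivation of the associative product.  So exp(tD) acts on
   1 + n_Q by automorphisms, and x |-> D x / 2 is the soliton field.

   In the global chart the left-invariant metric is g_x(u, v) = <L u, L v> with
   L = (1 + x)^{-1}, and its Christoffel symbols are (1 + x) G(L u, L v) for a constant
   bilinear map G; L is polynomial in x because n_Q is nilpotent. *)

Set Implicit Arguments.
Unset Strict Implicit.
Unset Printing Implicit Defensive.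

Import Order.TTheory GRing.Theory Num.Theory.
Import numFieldNormedType.Exports.

Local Open Scope ring_scope.

(** * Polynomial functions and their partial derivatives *)

Section PolynomialFunctions.
Context {R : realType} {n : nat}.
Implicit Types (f g : 'rV[R]_n -> R) (i : 'I_n) (x : 'rV[R]_n).

(** The metric, its Christoffel symbols and the soliton field are all polynomial in the chart. This
    class is closed under partial derivatives, so smoothness and the product rule need no further
    analysis. *)
Inductive poly_fun : ('rV[R]_n -> R) -> Prop :=
| poly_cst c : poly_fun (fun=> c)
| poly_coord i : poly_fun (fun x => x 0 i)
| poly_add f g : poly_fun f -> poly_fun g -> poly_fun (fun x => f x + g x)
| poly_mul f g : poly_fun f -> poly_fun g -> poly_fun (fun x => f x * g x).

Lemma poly_differentiable f x : poly_fun f -> differentiable f x.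
Proof.
elim=> [c|i|{}f g _ df _ dg|{}f g _ df _ dg].
- exact: differentiable_cst.
- exact: differentiable_coord.
- exact: (differentiableD df dg).
- exact: (differentiableM df dg).
Qed.

Lemma poly_derivable f x v : poly_fun f -> derivable f x v.
Proof. by move=> pf; apply/diff_derivable/poly_differentiable. Qed.

Lemma partial_cst i c : partial i (fun=> c) = (fun=> 0) :> ('rV[R]_n -> R).
Proof. by apply/funext => x; rewrite /partial derive_cst. Qed.

Lemma partial_coord i j : partial i (fun x : 'rV[R]_n => x 0 j) = fun=> (j == i)%:R.
Proof.
apply/funext => x; rewrite /partial /derive; apply: cvg_lim => //.
apply: cvg_trans (@cvg_cst R (j == i)%:R _ _ _).
apply: near_eq_cvg; near=> h.
have h0 : h != 0 by near: h; exact: nbhs_dnbhs_neq.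
by rewrite /= !mxE addrK eqxx /GRing.scale /= mulKf.
exact: _.
Unshelve. all: by end_near.
Qed.

Lemma partialD i f g : poly_fun f -> poly_fun g ->
  partial i (fun x => f x + g x) = fun x => partial i f x + partial i g x.
Proof.
by move=> pf pg; apply/funext => x; rewrite /partial deriveD //; exact: poly_derivable.
Qed.

Lemma partialM i f g : poly_fun f -> poly_fun g ->
  partial i (fun x => f x * g x) = fun x => partial i f x * g x + f x * partial i g x.
Proof.
move=> pf pg; apply/funext => x; rewrite /partial deriveM; try exact: poly_derivable.
by rewrite addrC; congr (_ + _); exact: mulrC.
Qed.

Lemma poly_partial i f : poly_fun f -> poly_fun (partial i f).
Proof.
elim=> [c|j|{}f g pf df pg dg|{}f g pf df pg dg].
- rewrite partial_cst; exact: poly_cst.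
- rewrite partial_coord; exact: poly_cst.
- rewrite partialD //; exact: poly_add.
- by rewrite partialM //; apply: poly_add; apply: poly_mul.
Qed.

Lemma poly_smooth f : poly_fun f -> smooth f.
Proof.
move=> pf m; elim: m f pf => [|m IH] f pf /=.
  by move=> x; exact/differentiable_continuous/poly_differentiable.
split; first by move=> x; exact/differentiable_continuous/poly_differentiable.
by move=> i; split; [move=> x; exact: poly_derivable|apply/IH/poly_partial].
Qed.

Lemma poly_sum (I : Type) (r : seq I) (F : I -> 'rV[R]_n -> R) :
  (forall k, poly_fun (F k)) -> poly_fun (fun x => \sum_(k <- r) F k x).
Proof.
move=> pF; elim: r => [|k r IH].
  rewrite (_ : (fun _ => _) = fun=> 0); first exact: poly_cst.
  by apply/funext => x; rewrite big_nil.
rewrite (_ : (fun _ => _) = fun x => F k x + \sum_(k <- r) F k x); first exact: poly_add.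
by apply/funext => x; rewrite big_cons.
Qed.

Lemma partial_sum (I : Type) (r : seq I) (F : I -> 'rV[R]_n -> R) i :
  (forall k, poly_fun (F k)) ->
  partial i (fun x => \sum_(k <- r) F k x) = fun x => \sum_(k <- r) partial i (F k) x.
Proof.
move=> pF; elim: r => [|k r IH].
  rewrite (_ : (fun _ => _) = fun=> 0).
    by rewrite partial_cst; apply/funext => x; rewrite big_nil.
  by apply/funext => x; rewrite big_nil.
rewrite (_ : (fun _ => _) = fun x => F k x + \sum_(k <- r) F k x).
  rewrite partialD //; last exact: poly_sum.
  by rewrite IH; apply/funext => x; rewrite big_cons.
by apply/funext => x; rewrite big_cons.
Qed.

(** * Matrix-valued polynomial maps *)

Definition poly_mx p q (A : 'rV[R]_n -> 'M[R]_(p, q)) := forall a b, poly_fun (fun x => A x a b).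

Definition partial_mx p q i (A : 'rV[R]_n -> 'M[R]_(p, q)) x : 'M[R]_(p, q) :=
  \matrix_(a, b) partial i (fun y => A y a b) x.

Lemma poly_mx_cst p q (A : 'M[R]_(p, q)) : poly_mx (fun=> A).
Proof. by move=> a b; exact: poly_cst. Qed.

Lemma partial_mx_cst p q i (A : 'M[R]_(p, q)) x : partial_mx i (fun=> A) x = 0.
Proof. by apply/matrixP => a b; rewrite !mxE partial_cst. Qed.

Lemma poly_mxM p q r (A : 'rV[R]_n -> 'M[R]_(p, q)) (B : 'rV[R]_n -> 'M[R]_(q, r)) :
  poly_mx A -> poly_mx B -> poly_mx (fun x => A x *m B x).
Proof.
move=> pA pB a b.
rewrite (_ : (fun _ => _) = fun x => \sum_k A x a k * B x k b).
  by apply: poly_sum => k; exact: poly_mul.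
by apply/funext => x; rewrite mxE.
Qed.

Lemma partial_mxM p q r i (A : 'rV[R]_n -> 'M[R]_(p, q)) (B : 'rV[R]_n -> 'M[R]_(q, r)) x :
  poly_mx A -> poly_mx B -> partial_mx i (fun x => A x *m B x) x =
  partial_mx i A x *m B x + A x *m partial_mx i B x.
Proof.
move=> pA pB; apply/matrixP => a b; rewrite !mxE.
rewrite (_ : (fun _ => _) = fun x => \sum_k A x a k * B x k b); last first.
  by apply/funext => y; rewrite mxE.
rewrite partial_sum; last by move=> k; exact: poly_mul.
by rewrite -big_split; apply: eq_bigr => k _ /=; rewrite partialM // !mxE.
Qed.

Lemma poly_mxT p q (A : 'rV[R]_n -> 'M[R]_(p, q)) : poly_mx A -> poly_mx (fun x => (A x)^T).
Proof.
move=> pA a b; rewrite (_ : (fun _ => _) = fun x => A x b a); first exact: pA.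
by apply/funext => x; rewrite mxE.
Qed.

Lemma partial_mxT p q i (A : 'rV[R]_n -> 'M[R]_(p, q)) x :
  partial_mx i (fun x => (A x)^T) x = (partial_mx i A x)^T.
Proof.
apply/matrixP => a b; rewrite !mxE; congr (partial i _ x).
by apply/funext => y; rewrite mxE.
Qed.

Lemma linear_row_sum p q r (f : {linear 'rV[R]_r -> 'M[R]_(p, q)}) (A : 'rV[R]_n -> 'rV[R]_r) a b :
  (fun x => f (A x) a b) = fun x => \sum_k A x 0 k * f (delta_mx 0 k) a b.
Proof.
apply/funext => x; rewrite {1}(row_sum_delta (A x)) linear_sum summxE.
by apply: eq_bigr => k _; rewrite linearZ mxE.
Qed.

Lemma poly_mx_linear p q r (f : {linear 'rV[R]_r -> 'M[R]_(p, q)}) (A : 'rV[R]_n -> 'rV[R]_r) :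
  poly_mx A -> poly_mx (fun x => f (A x)).
Proof.
move=> pA a b; rewrite linear_row_sum; apply: poly_sum => k.
by apply: poly_mul; [exact: pA|exact: poly_cst].
Qed.

Lemma partial_mx_linear p q r i (f : {linear 'rV[R]_r -> 'M[R]_(p, q)})
    (A : 'rV[R]_n -> 'rV[R]_r) x :
  poly_mx A -> partial_mx i (fun x => f (A x)) x = f (partial_mx i A x).
Proof.
move=> pA; apply/matrixP => a b; rewrite mxE linear_row_sum partial_sum; last first.
  by move=> k; apply: poly_mul; [exact: pA|exact: poly_cst].
rewrite [in RHS](row_sum_delta (partial_mx i A x)) linear_sum summxE.
apply: eq_bigr => k _; rewrite linearZ [in RHS]mxE !mxE partialM //; last exact: poly_cst.
by rewrite partial_cst mulr0 addr0.
Qed.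

Lemma poly_mx_id : poly_mx (fun x : 'rV[R]_n => x).
Proof. by move=> a b; rewrite ord1; exact: poly_coord. Qed.

Lemma partial_mx_id i x : partial_mx i (fun x : 'rV[R]_n => x) x = delta_mx 0 i.
Proof. by apply/rowP => j; rewrite !mxE partial_coord eqxx. Qed.

Lemma poly_mx_row p q (A : 'rV[R]_n -> 'M[R]_(p, q)) k :
  poly_mx A -> poly_mx (fun x => row k (A x)).
Proof.
move=> pA a b; rewrite (_ : (fun _ => _) = fun x => A x k b); first exact: pA.
by apply/funext => x; rewrite mxE.
Qed.

Lemma partial_mx_row p q i (A : 'rV[R]_n -> 'M[R]_(p, q)) k x :
  partial_mx i (fun x => row k (A x)) x = row k (partial_mx i A x).
Proof.
apply/matrixP => a b; rewrite !mxE; congr (partial i _ x).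
by apply/funext => y; rewrite mxE.
Qed.

Lemma partial_mxE p q i (A : 'rV[R]_n -> 'M[R]_(p, q)) x a b :
  partial i (fun y => A y a b) x = partial_mx i A x a b.
Proof. by rewrite mxE. Qed.

End PolynomialFunctions.

(** * Graded associative algebras given by structure constants *)

Section GradedAlgebra.
Context {R : realType} {n : nat}.
Variables (C : 'I_n -> 'M[R]_n) (deg : 'I_n -> nat).
Implicit Types (u v b c x : 'rV[R]_n) (i j k l : 'I_n).

(* With structure constants [C i j k] and row vectors, the product [u v] is both
   [v *m lmx u] and [u *m rmx v]. *)
Definition lmx u : 'M[R]_n := \sum_i u 0 i *: C i.
Definition rmx u : 'M[R]_n := \matrix_i (u *m C i).

Fact lmx_linear : linear lmx.
Proof.
move=> a u v; rewrite /lmx scaler_sumr -big_split; apply: eq_bigr => i _ /=.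
by rewrite !mxE scalerDl scalerA.
Qed.
HB.instance Definition _ := GRing.isLinear.Build R _ _ _ lmx lmx_linear.

Fact rmx_linear : linear rmx.
Proof.
move=> a u v; apply/row_matrixP => i.
by rewrite linearP /= !rowK mulmxDl -scalemxAl.
Qed.
HB.instance Definition _ := GRing.isLinear.Build R _ _ _ rmx rmx_linear.

Lemma lmx_delta i : lmx (delta_mx 0 i) = C i.
Proof.
rewrite /lmx (bigD1 i) //= mxE !eqxx scale1r big1 ?addr0 // => j ne.
by rewrite mxE eqxx /= (negbTE ne) scale0r.
Qed.

Lemma mul_rmx u v : u *m rmx v = v *m lmx u.
Proof.
rewrite mulmx_sum_row mulmx_sumr; apply: eq_bigr => i _.
by rewrite rowK scalemxAr.
Qed.

(** The form in which nilpotency enters: arguments go by induction on [deg]. *)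
Hypothesis C_graded : forall i j k, C i j k != 0 -> (deg i < deg k)%N /\ (deg j < deg k)%N.
(** Associativity u (v z) = (u v) z; acting on row vectors reverses the order of the factors. *)
Hypothesis lmxM : forall u v, lmx (v *m lmx u) = lmx v *m lmx u.

(** Strict triangularity relative to [deg], without ordering the basis. *)
Definition raising (A : 'M[R]_n) := forall j k, A j k != 0 -> (deg j < deg k)%N.

Lemma raisingP A : raising A <-> forall j k, (deg k <= deg j)%N -> A j k = 0.
Proof.
split=> rA j k; first by rewrite leqNgt => /negP nd; apply/eqP/negPn/negP => /rA.
by rewrite ltnNge; apply: contraNN => /rA ->.
Qed.

Lemma raising_sum (I : finType) (F : I -> 'M[R]_n) :
  (forall s, raising (F s)) -> raising (\sum_s F s).
Proof.
move=> rF; apply/raisingP => j k d; rewrite summxE big1 // => s _.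
by move/raisingP: (rF s); apply.
Qed.

Lemma raisingD A B : raising A -> raising B -> raising (A + B).
Proof.
by move=> /raisingP rA /raisingP rB; apply/raisingP => j k d; rewrite mxE rA ?rB ?addr0.
Qed.

Lemma raisingZ a A : raising A -> raising (a *: A).
Proof. by move=> /raisingP rA; apply/raisingP => j k d; rewrite mxE rA ?mulr0. Qed.

Lemma raisingN A : raising A -> raising (- A).
Proof. by rewrite -scaleN1r; exact: raisingZ. Qed.

Lemma raisingM A B : raising A -> raising B -> raising (A *m B).
Proof.
move=> rA rB j k; apply: contraNT; rewrite -leqNgt => d.
rewrite mxE big1 // => l _; apply/eqP; rewrite mulf_eq0; apply/orP.
case: (eqVneq (A j l) 0) => [|/rA jl]; first by left.
case: (eqVneq (B l k) 0) => [|/rB lk]; first by right.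
by have := leq_trans (ltn_trans jl lk) d; rewrite ltnn.
Qed.

Lemma raising_lmx u : raising (lmx u).
Proof. by apply: raising_sum => i; apply: raisingZ => j k /C_graded[]. Qed.

Lemma raising_rmx u : raising (rmx u).
Proof.
apply/raisingP => j k d; rewrite !mxE big1 // => i _.
case: (eqVneq (C j i k) 0) => [->|/C_graded[]]; first by rewrite mulr0.
by rewrite ltnNge d.
Qed.

Lemma mxtrace_raising A : raising A -> \tr A = 0.
Proof. by move=> /raisingP rA; apply: big1 => i _; exact: rA. Qed.

(* The rows of [frame x] are the left-invariant fields at [x]: [u *m frame x] is [(1 + x) u]. *)
Definition frame x : 'M[R]_n := 1%:M + lmx x.
Definition coframe x : 'M[R]_n := invmx (frame x).

(** * Inverse and derivatives of the left-invariant frame *)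

Lemma frame_unit x : frame x \in unitmx.
Proof.
rewrite -row_free_unit -kermx_eq0; apply/eqP/row_matrixP => i; rewrite row0.
(* A kernel vector y satisfies y = - x y, so its coordinates vanish by induction on the degree. *)
set y := row i _; have y0 : y = - (y *m lmx x).
  apply/eqP; rewrite -addr_eq0 -{1}[y]mulmx1 -mulmxDr -/(frame x).
  by rewrite -row_mul mulmx_ker row0.
apply/rowP => k; rewrite [RHS]mxE; have [m] := ubnP (deg k).
elim: m k => // m IH k km; rewrite y0 !mxE big1 ?oppr0 // => j _.
case: (eqVneq (lmx x j k) 0) => [->|/raising_lmx d]; first by rewrite mulr0.
by rewrite IH ?mul0r //; exact: leq_trans d _.
Qed.

Lemma frameK x : frame x *m coframe x = 1%:M.
Proof. exact/mulmxV/frame_unit. Qed.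
Lemma coframeK x : coframe x *m frame x = 1%:M.
Proof. exact/mulVmx/frame_unit. Qed.

Lemma poly_frame : poly_mx frame.
Proof.
move=> a b; rewrite (_ : (fun _ => _) = fun x => (1%:M : 'M[R]_n) a b + lmx x a b).
  apply: poly_add; first exact: poly_cst.
  exact: (poly_mx_linear lmx poly_mx_id).
by apply/funext => x; rewrite mxE.
Qed.

Lemma partial_frame i x : partial_mx i frame x = C i.
Proof.
have -> : partial_mx i frame x = partial_mx i (fun y => lmx y) x.
  apply/matrixP => a b; rewrite !mxE.
  rewrite (_ : (fun _ => _) = fun y => (1%:M : 'M[R]_n) a b + lmx y a b); last first.
    by apply/funext => y; rewrite mxE.
  rewrite partialD; [|exact: poly_cst|exact: (poly_mx_linear lmx poly_mx_id)].
  by rewrite partial_cst add0r.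
by rewrite (partial_mx_linear _ lmx _ poly_mx_id) partial_mx_id /= lmx_delta.
Qed.

(** As [coframe x] is 1 minus [coframe x *m lmx x] and [lmx x] raises degrees, column b is
    polynomial in x and the columns of smaller degree. *)
Lemma poly_coframe : poly_mx coframe.
Proof.
move=> a b; have [m] := ubnP (deg b); elim: m b => // m IH b bm.
(* The degree test keeps each summand within the induction hypothesis; the terms it drops are
   zero. *)
rewrite (_ : (fun _ => _) = fun x => (a == b)%:R + (-1) *
    \sum_k (if (deg k < deg b)%N then coframe x a k * lmx x k b else 0)).
  apply: poly_add; first exact: poly_cst.
  apply: poly_mul; first exact: poly_cst.
  apply: poly_sum => k; case: (ltnP (deg k) (deg b)) => d; last exact: poly_cst.
  apply: poly_mul; last exact: (poly_mx_linear lmx poly_mx_id).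
  by apply: IH; exact: leq_trans d _.
apply/funext => x; have /matrixP/(_ a b) := coframeK x.
rewrite {1}/frame mulmxDr mulmx1 !mxE => <-; rewrite mulN1r.
rewrite [X in _ - X](eq_bigr (fun k => coframe x a k * lmx x k b)); first by rewrite addrK.
move=> k _; case: ifP => // /negbT; rewrite -leqNgt => d.
by move/raisingP: (@raising_lmx x) => ->; rewrite ?mulr0.
Qed.

(** Associativity for the inverse: (1 + x)^{-1} (u z) = ((1 + x)^{-1} u) z. *)
Lemma lmx_coframe u x : lmx u *m coframe x = lmx (u *m coframe x).
Proof.
apply: (can_inj (mulmxK (frame_unit x))); rewrite -mulmxA coframeK mulmx1.
by rewrite {1}/frame mulmxDr mulmx1 -lmxM -linearD -{1}[_ *m coframe x]mulmx1 -mulmxDr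
  -mulmxA coframeK mulmx1.
Qed.

Lemma C_coframe i x : C i *m coframe x = lmx (row i (coframe x)).
Proof. by rewrite -lmx_delta lmx_coframe -rowE. Qed.

Lemma C_frame i x : C i = lmx (row i (coframe x)) *m frame x.
Proof. by rewrite -C_coframe -mulmxA coframeK mulmx1. Qed.

(** The derivative - T (dM) T of the inverse T of M, where dM is [C i]; [C_coframe] merges the last
    two factors into a left multiplication. *)
Lemma partial_coframe i x :
  partial_mx i coframe x = - (coframe x *m lmx (row i (coframe x))).
Proof.
apply/eqP; rewrite -addr_eq0 -C_coframe; apply/eqP.
apply: (can_inj (mulmxK (frame_unit x))); rewrite mul0mx mulmxDl -!mulmxA coframeK mulmx1.
have := partial_mxM i x poly_coframe poly_frame; rewrite partial_frame => <-.
rewrite (_ : (fun _ => _) = fun=> 1%:M) ?partial_mx_cst //.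
by apply/funext => y; rewrite coframeK.
Qed.

(** * Inner product, adjoints and the Levi-Civita form *)

Variable w : 'rV[R]_n.
Hypothesis w_gt0 : forall i, 0 < w 0 i.

Definition wmx : 'M[R]_n := diag_mx w.
Definition wmx_inv : 'M[R]_n := diag_mx (map_mx (fun t => t^-1) w).

Lemma wmxK : wmx *m wmx_inv = 1%:M.
Proof.
rewrite mul_diag_mx; apply/matrixP => i j; rewrite !mxE.
case: eqP => [->|_]; last by rewrite mulr0.
by rewrite mulr1n mulfV // gt_eqF.
Qed.

Lemma wmx_invK : wmx_inv *m wmx = 1%:M.
Proof. exact: mulmx1C wmxK. Qed.

Lemma trmx_wmx : wmx^T = wmx. Proof. exact: tr_diag_mx. Qed.
Lemma trmx_wmx_inv : wmx_inv^T = wmx_inv. Proof. exact: tr_diag_mx. Qed.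

(* The adjoint for the inner product [<u, v> = u *m wmx *m v^T]. *)
Definition adjoint (A : 'M[R]_n) : 'M[R]_n := wmx *m A^T *m wmx_inv.

Fact adjoint_linear : linear adjoint.
Proof.
by move=> a A B; rewrite /adjoint linearP mulmxDr mulmxDl -scalemxAr -scalemxAl.
Qed.
HB.instance Definition _ := GRing.isLinear.Build R _ _ _ adjoint adjoint_linear.

Lemma adjoint_wmx A : adjoint A *m wmx = wmx *m A^T.
Proof. by rewrite /adjoint -mulmxA wmx_invK mulmx1. Qed.

Lemma adjointK A : adjoint (adjoint A) = A.
Proof.
rewrite /adjoint !trmx_mul trmxK trmx_wmx trmx_wmx_inv !mulmxA wmxK mul1mx.
by rewrite -mulmxA wmxK mulmx1.
Qed.

Lemma adjointM A B : adjoint (A *m B) = adjoint B *m adjoint A.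
Proof. by rewrite /adjoint trmx_mul !mulmxA -[_ *m wmx_inv *m wmx]mulmxA wmx_invK mulmx1. Qed.

Lemma mxtrace_adjoint A : \tr (adjoint A) = \tr A.
Proof. by rewrite /adjoint mxtrace_mulC mulmxA wmx_invK mul1mx mxtrace_tr. Qed.

(* [u *m bmx b *m v^T] is [<u v, b>]. *)
Definition bmx b : 'M[R]_n := \matrix_(j, k) (C j *m wmx *m b^T) k 0.

Fact bmx_linear : linear bmx.
Proof.
move=> a u v; apply/matrixP => j k.
by rewrite [LHS]mxE linearP mulmxDr -scalemxAr !mxE.
Qed.
HB.instance Definition _ := GRing.isLinear.Build R _ _ _ bmx bmx_linear.

Lemma mul_bmx u b : u *m bmx b = b *m wmx *m (lmx u)^T.
Proof.
transitivity (lmx u *m wmx *m b^T)^T; last by rewrite !trmx_mul trmxK trmx_wmx mulmxA.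
apply/rowP => k; rewrite [LHS]mxE [RHS]mxE /lmx !mulmx_suml summxE.
by apply: eq_bigr => j _; rewrite -!scalemxAl [RHS]mxE [bmx _ _ _]mxE.
Qed.

Lemma mul_bmxT u b : u *m (bmx b)^T = b *m wmx *m (rmx u)^T.
Proof.
apply: trmx_inj; rewrite !trmx_mul !trmxK trmx_wmx.
apply/row_matrixP => j; rewrite [RHS]row_mul rowK -!mulmxA; apply/rowP => a.
rewrite ord1 [RHS]mxE [LHS]mxE [LHS]mxE; apply: eq_bigr => k _.
by rewrite mulrC [u^T _ _]mxE [bmx _ _ _]mxE mulmxA.
Qed.

(* [<u *m jmx b, v> = <v u - u v, b>]. *)
Definition jmx b : 'M[R]_n := ((bmx b)^T - bmx b) *m wmx_inv.

Fact jmx_linear : linear jmx.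
Proof.
move=> a u v; rewrite /jmx (linearP bmx) [(_ + _)^T]linearP /= opprD addrACA -scalerBr.
by rewrite mulmxDl -scalemxAl.
Qed.
HB.instance Definition _ := GRing.isLinear.Build R _ _ _ jmx jmx_linear.

(** Both sides represent the functional v |-> <v b - b v, c>. *)
Lemma mul_adjoint_rlmx b c : c *m adjoint (rmx b - lmx b) = b *m jmx c.
Proof.
by rewrite /adjoint /jmx !mulmxA linearB /= !mulmxBr mul_bmx mul_bmxT.
Qed.

(* [v *m smx u] is [G(u, v)] where the Levi-Civita connection at the unit is [G(u, v) + u v]. *)
Definition smx b : 'M[R]_n :=
  2^-1 *: (jmx b - lmx b - rmx b + adjoint (rmx b - lmx b)).

Fact smx_linear : linear smx.
Proof.
move=> a u v; rewrite /smx !(linearP jmx, linearP lmx, linearP rmx, linearB adjoint) /=.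
apply/matrixP => i j; rewrite !(linearP adjoint) !mxE; ring.
Qed.
HB.instance Definition _ := GRing.isLinear.Build R _ _ _ smx smx_linear.

(** Symmetry of G is torsion-freeness, since the other term u v of the connection already yields the
    bracket. The swap exchanges [jmx] with the adjoint term and [lmx] with [rmx]. *)
Lemma smxC b c : c *m smx b = b *m smx c.
Proof.
rewrite /smx -!scalemxAr !mulmxDr !mul_adjoint_rlmx !mulmxN !mul_rmx; congr (_ *: _).
by rewrite [LHS](ACl (4*3*2*1)).
Qed.

(** * The left-invariant metric and its Christoffel symbols *)

Definition frame_metric x := coframe x *m wmx *m (coframe x)^T.

Lemma poly_frame_metric : poly_mx frame_metric.
Proof.
apply: (@poly_mxM _ _ _ _ _ (fun x => coframe x *m wmx) (fun x => (coframe x)^T)).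
  by apply: poly_mxM; [exact: poly_coframe|exact: poly_mx_cst].
exact/poly_mxT/poly_coframe.
Qed.

(** With a_i = [row i (coframe x)], the (j, l) entry is <a_i a_j, a_l>. *)
Definition fmx i x : 'M[R]_n := coframe x *m lmx (row i (coframe x)) *m wmx *m (coframe x)^T.

Lemma partial_frame_metric i x : partial_mx i frame_metric x = - fmx i x - (fmx i x)^T.
Proof.
rewrite (@partial_mxM _ _ _ _ _ _ (fun x => coframe x *m wmx) (fun x => (coframe x)^T)); last first.
- exact/poly_mxT/poly_coframe.
- by apply: poly_mxM; [exact: poly_coframe|exact: poly_mx_cst].
rewrite partial_mxM; [|exact: poly_coframe|exact: poly_mx_cst].
rewrite partial_mx_cst mulmx0 addr0 partial_mxT partial_coframe.
by rewrite /fmx !mulNmx !trmx_mul trmxK trmx_wmx linearN mulmxN /= trmx_mul !mulmxA.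
Qed.

Lemma trmx_frame_metric x : (frame_metric x)^T = frame_metric x.
Proof. by rewrite /frame_metric !trmx_mul trmxK trmx_wmx mulmxA. Qed.

Lemma invmx_frame_metric x : invmx (frame_metric x) = (frame x)^T *m wmx_inv *m frame x.
Proof.
have E : frame_metric x *m ((frame x)^T *m wmx_inv *m frame x) = 1%:M.
  rewrite /frame_metric -!mulmxA [_^T *m (_^T *m _)]mulmxA -trmx_mul frameK trmx1 mul1mx.
  by rewrite [wmx *m _]mulmxA wmxK mul1mx coframeK.
have gu : frame_metric x \in unitmx by case/mulmx1_unit: E.
by rewrite -[RHS](mulKmx gu) E mulmx1.
Qed.

(** Here and in [fmx_bmx] an entry is again a value of <a_p a_q, a_r>, with the indices permuted. *)
Lemma fmx_rmx i j l x :
  (coframe x *m rmx (row i (coframe x)) *m wmx *m (coframe x)^T) j l = fmx j x i l.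
Proof.
have rowE0 (A : 'M[R]_n) p q : A p q = row p A 0 q by rewrite mxE.
by rewrite [LHS]rowE0 [RHS]rowE0 !row_mul mul_rmx.
Qed.

Lemma fmx_bmx i j l x :
  (coframe x *m bmx (row i (coframe x)) *m (coframe x)^T) j l = fmx j x l i.
Proof.
have rowE0 (A : 'M[R]_n) p q : A p q = row p A 0 q by rewrite mxE.
have -> : fmx j x l i = (fmx j x)^T i l by rewrite [RHS]mxE.
by rewrite /fmx !trmx_mul trmxK trmx_wmx [LHS]rowE0 [RHS]rowE0 !row_mul mul_bmx !mulmxA.
Qed.

(** By [partial_frame_metric] the right side is the Christoffel symbol of the first kind, so G is
    the Christoffel tensor read in the frame. *)
Lemma smx_fmx x i j l :
  (coframe x *m smx (row i (coframe x)) *m wmx *m (coframe x)^T) j l =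
  2^-1 * (fmx l x i j + fmx l x j i - fmx i x j l - fmx i x l j - fmx j x i l - fmx j x l i).
Proof.
set a := row i (coframe x); set T := coframe x.
have -> : T *m smx a *m wmx *m T^T = 2^-1 *: ((T *m bmx a *m T^T)^T - T *m bmx a *m T^T
    - T *m lmx a *m wmx *m T^T - T *m rmx a *m wmx *m T^T
    + (T *m rmx a *m wmx *m T^T)^T - (T *m lmx a *m wmx *m T^T)^T).
  rewrite /smx -scalemxAr -!scalemxAl; congr (_ *: _).
  rewrite !(mulmxDr, mulmxN, mulmxDl, mulNmx) -!(mulmxA T (adjoint _)) adjoint_wmx.
  rewrite /jmx -!(mulmxA T (_ *m wmx_inv)) -(mulmxA _ wmx_inv) wmx_invK mulmx1.
  rewrite linearB /= !(mulmxBr, mulmxBl) !trmx_mul !trmxK trmx_wmx !mulmxA.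
  by rewrite [(rmx a - lmx a)^T]linearB /= mulmxBr mulmxBl addrA.
rewrite [LHS]mxE; congr (_ * _).
have eB p q : (T *m bmx a *m T^T) p q = _ := fmx_bmx i p q x.
have eF p q : (T *m rmx a *m wmx *m T^T) p q = _ := fmx_rmx i p q x.
rewrite -[T *m lmx a *m wmx *m T^T]/(fmx i x).
move: (eB j l) (eB l j) (eF j l) (eF l j).
move: (fmx i x) (fmx j x) (fmx l x) (T *m rmx a *m wmx *m T^T) (T *m bmx a *m T^T).
move=> Fi Fj Fl F B e1 e2 e3 e4; rewrite !mxE e1 e2 e3 e4; ring.
Qed.

Lemma christoffelE i j k x : christoffel frame_metric k i j x =
  (coframe x *m smx (row i (coframe x)) *m frame x) j k.
Proof.
rewrite /christoffel.
set S := coframe x *m _.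
(* Twice the symbols of the first kind, to absorb the factor 2^-1 of [christoffel]; raising the
   index cancels [wmx *m (coframe x)^T]. *)
pose h : 'rV[R]_n := \row_l (2 *: (S *m wmx *m (coframe x)^T)) j l.
rewrite (eq_bigr (fun l => h 0 l * invmx (frame_metric x) l k)); last first.
  move=> l _; rewrite mulrC; congr (_ * _); last first.
    by rewrite -[in LHS](trmx_frame_metric x) -trmx_inv mxE.
  rewrite !partial_mxE !partial_frame_metric [RHS]mxE [RHS]mxE smx_fmx !mxE; lra.
have -> : \sum_l h 0 l * invmx (frame_metric x) l k = (h *m invmx (frame_metric x)) 0 k by rewrite mxE.
have -> : h = 2 *: row j (S *m wmx *m (coframe x)^T).
  by apply/rowP => l; rewrite !mxE.
rewrite -[_ *m invmx _]scalemxAl [X in _ * X = _]mxE mulrA mulVf ?pnatr_eq0 // mul1r.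
rewrite -row_mul mxE invmx_frame_metric.
rewrite -!mulmxA [_^T *m (_^T *m _)]mulmxA -trmx_mul frameK trmx1 mul1mx.
by rewrite [wmx *m _]mulmxA wmxK mul1mx.
Qed.

(** * Ricci curvature at the unit *)

Definition admx b : 'M[R]_n := lmx b - rmx b.

(** The classical Ricci formula for nilpotent Lie algebras, whose Killing form and traces of ad
    vanish. *)
Definition ric_form b c : R :=
  - 2^-1 * \tr (admx b *m adjoint (admx c)) - 4^-1 * \tr (jmx b *m jmx c).

Lemma raising_admx b : raising (admx b).
Proof. exact/raisingD/raisingN/raising_rmx/raising_lmx. Qed.

Lemma adjoint_jmx b : adjoint (jmx b) = - jmx b.
Proof.
rewrite /adjoint /jmx !trmx_mul trmx_wmx_inv mulmxA wmxK mul1mx -mulNmx opprB.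
by rewrite [(_ - _)^T]linearB /= trmxK.
Qed.

(** Twice the covariant derivative v |-> nabla_v b of the left-invariant field b, at the unit. *)
Definition tmx b := jmx b - admx b - adjoint (admx b).

Lemma smxE b : smx b = 2^-1 *: tmx b - rmx b.
Proof.
have E : adjoint (rmx b - lmx b) = - adjoint (admx b) by rewrite -[RHS]linearN opprB.
rewrite /smx /tmx E {2}/admx.
move: (adjoint _) (jmx b) (lmx b) (rmx b) => A J L S.
by apply/matrixP => i j; rewrite !mxE; lra.
Qed.

Let trB (A B : 'M[R]_n) : \tr (A - B) = \tr A - \tr B.
Proof. exact: raddfB. Qed.

Let trN (A : 'M[R]_n) : \tr (- A) = - \tr A.
Proof. exact: raddfN. Qed.

(** As [jmx] is skew-adjoint, its cross terms with [admx] and with the adjoint of [admx] cancel;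
    products of two [admx] are traceless by degree. *)
Lemma mxtrace_tmx b c : \tr (tmx b *m tmx c) =
  \tr (jmx b *m jmx c) + 2 * \tr (admx b *m adjoint (admx c)).
Proof.
have h1 u v : \tr (jmx u *m adjoint (admx v)) = - \tr (jmx u *m admx v).
  by rewrite -mxtrace_adjoint adjointM adjointK adjoint_jmx mulmxN raddfN /= mxtrace_mulC.
have h2 : \tr (admx b *m admx c) = 0.
  exact/mxtrace_raising/raisingM/raising_admx/raising_admx.
have h3 : \tr (adjoint (admx b) *m adjoint (admx c)) = 0.
  by rewrite -adjointM mxtrace_adjoint mxtrace_mulC.
have h4 : \tr (adjoint (admx b) *m admx c) = \tr (admx b *m adjoint (admx c)).
  by rewrite -mxtrace_adjoint adjointM adjointK mxtrace_mulC.
move: (h1 b c) (h1 c b) h2 h3 h4; rewrite /tmx.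
move: (admx b) (admx c) (jmx b) (jmx c) => A B I J e1 e2 e3 e4 e5.
rewrite !(mulmxBl, mulmxBr) !trB e1 e3 e4 e5.
rewrite [\tr (A *m J)]mxtrace_mulC [\tr (adjoint _ *m J)]mxtrace_mulC e2; ring.
Qed.

Lemma mxtrace_smx b : \tr (smx b) = 0.
Proof.
have j0 : \tr (jmx b) = 0.
  have := mxtrace_adjoint (jmx b); rewrite adjoint_jmx raddfN /= => /eqP.
  by rewrite eq_sym -addr_eq0 -mulr2n mulrn_eq0 /= => /eqP.
have a0 := mxtrace_raising (@raising_admx b).
rewrite smxE trB mxtraceZ (mxtrace_raising (@raising_rmx b)) /tmx.
by move: (admx b) a0 => A a0; rewrite !trB mxtrace_adjoint j0 a0 !subr0 mulr0.
Qed.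

(* [c *m curv_mx a b] and [a *m ricci_mx b c] are both the curvature [R(a, b) c] at the
   unit, so that the Ricci form is the trace of [ricci_mx b c]. *)
Definition curv_mx a b := smx b *m lmx a - lmx a *m smx b - smx (b *m lmx a)
  - (smx a *m lmx b - lmx b *m smx a - smx (a *m lmx b)) + smx b *m smx a - smx a *m smx b.

Definition ricci_mx b c := rmx (c *m smx b) - rmx c *m smx b - rmx b *m smx c
  - smx c *m lmx b + smx (c *m lmx b) + lmx b *m smx c + smx (c *m smx b) - smx c *m smx b.

(** R(a, b) c is linear in a; the symmetry of G and [mul_rmx] bring a to the front of each term. *)
Lemma mul_curv_mx a b c : c *m curv_mx a b = a *m ricci_mx b c.
Proof.
rewrite /curv_mx /ricci_mx; move: smx lmx rmx smxC mul_rmx => S L T SC LT.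
rewrite !(mulmxDr, mulmxN, opprD, opprK) !mulmxA.
rewrite (SC (b *m L a) c) (SC a c) (SC a (c *m L b)) (SC (a *m L b) c).
by rewrite (SC a (c *m S b)) -!(LT a) !addrA.
Qed.

Let tr_half (T T' A A' : 'M[R]_n) : \tr (A' *m A) = 0 ->
  \tr ((2^-1 *: T - A) *m (2^-1 *: T' - A')) =
  4^-1 * \tr (T *m T') - 2^-1 * \tr (A *m T') - 2^-1 * \tr (A' *m T).
Proof.
move=> AA; rewrite mulmxBl !mulmxBr -!scalemxAl -!scalemxAr !trB !mxtraceZ.
rewrite [\tr (A *m A')]mxtrace_mulC AA [\tr (T *m A')]mxtrace_mulC; lra.
Qed.

(** The single [smx] and [rmx] are traceless and the products with [lmx b] cancel cyclically. By
    [smxE] the rest is -1/4 times the trace of [tmx b *m tmx c]. *)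
Lemma mxtrace_ricci_mx b c : \tr (ricci_mx b c) = ric_form b c.
Proof.
have r0 u : \tr (rmx u) = 0 := mxtrace_raising (@raising_rmx u).
have rr u v : \tr (rmx u *m rmx v) = 0.
  exact/mxtrace_raising/raisingM/raising_rmx/raising_rmx.
have rs u v : \tr (rmx u *m smx v) = 2^-1 * \tr (rmx u *m tmx v).
  rewrite smxE; move: (rmx u) (rmx v) (tmx v) (rr u v) => A A' T AA.
  by rewrite mulmxBr trB AA subr0 -scalemxAr mxtraceZ.
have ss : \tr (smx c *m smx b) = 4^-1 * \tr (tmx b *m tmx c)
    - 2^-1 * \tr (rmx b *m tmx c) - 2^-1 * \tr (rmx c *m tmx b).
  by rewrite mxtrace_mulC !smxE tr_half.
have := ss; rewrite mxtrace_tmx -/(ric_form b c).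
have := rs b c; have := rs c b; rewrite /ricci_mx /ric_form.
have := mxtrace_smx (c *m smx b); have := mxtrace_smx (c *m lmx b).
have := r0 (c *m smx b).
move: (\tr (jmx b *m _)) (\tr (admx b *m _)) (\tr (rmx c *m tmx b)) (\tr (rmx b *m tmx c)).
move: (smx (c *m smx b)) (smx (c *m lmx b)) (rmx (c *m smx b)) (smx b) (smx c) (lmx b).
move: (rmx b) (rmx c) => A B U V W S T L r1 r2 r3 r4 e1 e2 e3 e4 e5 e6.
rewrite !(mxtraceD, trN) e1 e2 e3 e4 e5 e6 [\tr (T *m L)]mxtrace_mulC.
move: (\tr (L *m T)) => t {e1 e2 e3 e4 e5 e6 ss rs rr r0}; lra.
Qed.

(** * Ricci curvature in the chart *)

Definition conn_mx i x : 'M[R]_n := coframe x *m smx (row i (coframe x)) *m frame x.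

Lemma poly_smx_coframe i : poly_mx (fun x => smx (row i (coframe x))).
Proof. apply: (poly_mx_linear smx); exact/poly_mx_row/poly_coframe. Qed.

(** The frame differentiates to [lmx a *m frame x] and the coframe to minus [coframe x *m lmx a], so
    both can still be factored out. *)
Lemma partial_conn_mx i j x : let a := row i (coframe x) in let b := row j (coframe x) in
  partial_mx i (conn_mx j) x = coframe x *m
    (smx b *m lmx a - lmx a *m smx b - smx (b *m lmx a)) *m frame x.
Proof.
move=> a b; rewrite /conn_mx.
rewrite (@partial_mxM _ _ _ _ _ _ (fun x => coframe x *m smx (row j (coframe x))) frame).
- rewrite partial_mxM; [|exact: poly_coframe|exact: poly_smx_coframe].
  rewrite partial_frame (C_frame i x) -/a partial_coframe -/a.
  rewrite (partial_mx_linear _ smx); last exact/poly_mx_row/poly_coframe.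
  rewrite partial_mx_row partial_coframe -/a [row j (- _)]linearN /= [smx (- _)]linearN /= row_mul -/b.
  move: (smx b) (lmx a) (smx (b *m lmx a)) (coframe x) (frame x) => S L S' T M.
  rewrite !(mulmxDr, mulmxDl, mulmxN, mulNmx) !mulmxA.
  by rewrite [LHS]addrC addrA.
- by apply: poly_mxM; [exact: poly_coframe|exact: poly_smx_coframe].
- exact: poly_frame.
Qed.

Lemma ricci_frame_metric x j k :
  ricci frame_metric x j k = ric_form (row j (coframe x)) (row k (coframe x)).
Proof.
set b := row j _; set c := row k _.
have chrE i p q : christoffel frame_metric q p i = fun y => conn_mx p y i q.
  by apply/funext => y; rewrite christoffelE.
(* The curvature operator R(e_i, e_j) in coordinates, conjugate to [curv_mx] by the frame. *)
pose U i := partial_mx i (conn_mx j) x - partial_mx j (conn_mx i) x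
  + conn_mx j x *m conn_mx i x - conn_mx i x *m conn_mx j x.
have UE i : U i = coframe x *m curv_mx (row i (coframe x)) b *m frame x.
  rewrite /U !partial_conn_mx /curv_mx -/b; set a := row i _.
  have conn2 p q : conn_mx p x *m conn_mx q x =
      coframe x *m (smx (row p (coframe x)) *m smx (row q (coframe x))) *m frame x.
    rewrite /conn_mx; move: (smx _) (smx _) => S S'.
    by rewrite !mulmxA -[_ *m frame x *m coframe x]mulmxA frameK mulmx1.
  have gen (T M U1 U2 U3 U4 : 'M[R]_n) : T *m U1 *m M - T *m U2 *m M + T *m U3 *m M
      - T *m U4 *m M = T *m (U1 - U2 + U3 - U4) *m M.
    by rewrite !(mulmxDr, mulmxDl, mulmxN, mulNmx).
  rewrite !conn2; exact: gen.
rewrite [LHS]mxE -(mxtrace_ricci_mx b c).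
transitivity (\sum_i U i k i).
  have entry i (P P' A B : 'M[R]_n) : P k i - P' k i +
      \sum_l (A l i * B k l - B l i * A k l) = (P - P' + B *m A - A *m B) k i.
    rewrite !mxE sumrB addrA; congr (_ + _ - _); apply: eq_bigr => l _; exact: mulrC.
  apply: eq_bigr => i _; rewrite !chrE !partial_mxE.
  under eq_bigr do rewrite !chrE.
  exact: entry.
(* Exchanging c with the varying row a by [mul_curv_mx] turns a sum over different matrices into one
   trace. *)
transitivity (\tr (coframe x *m ricci_mx b c *m frame x)); last first.
  by rewrite mxtrace_mulC mulmxA frameK mul1mx.
apply: eq_bigr => i _; rewrite UE.
have rowE0 (A : 'M[R]_n) p q : A p q = row p A 0 q by rewrite mxE.
by rewrite [LHS]rowE0 [RHS]rowE0 !row_mul -/c mul_curv_mx.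
Qed.

Lemma frame_metric_riemannian : riemannian_metric frame_metric.
Proof.
have gE x u : metric_at frame_metric x u u = \sum_i w 0 i * (u *m coframe x) 0 i ^+ 2.
  rewrite /metric_at /frame_metric !mulmxA -[_ *m _^T *m _]mulmxA -trmx_mul mul_mx_diag mxE.
  by apply: eq_bigr => i _; rewrite !mxE; ring.
split.
- by move=> i j; exact/poly_smooth/poly_frame_metric.
- move=> x u v; rewrite /metric_at.
  have T1 (A : 'M[R]_1) : A 0 0 = A^T 0 0 by rewrite mxE.
  by rewrite [LHS]T1 trmx_mul trmxK (trmx_mul u) trmx_frame_metric mulmxA.
- move=> x u u0; rewrite gE.
  have : u *m coframe x != 0.
    by apply: contraNneq u0 => uT0; rewrite -[u]mulmx1 -(coframeK x) mulmxA uT0 mul0mx.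
  case/rV0Pn => i ui; rewrite (bigD1 i) //= ltr_pwDl //.
    by rewrite mulr_gt0 ?w_gt0 // exprn_even_gt0.
  by apply: sumr_ge0 => j _; rewrite mulr_ge0 ?sqr_ge0 // ltW.
Qed.

(** * From a diagonal Ricci form to the soliton equation *)

Lemma scalar_sum_delta (f : 'rV[R]_n -> R) u :
  (forall a v v', f (a *: v + v') = a * f v + f v') ->
  f u = \sum_i u 0 i * f (delta_mx 0 i).
Proof.
move=> lf; pose F : {scalar 'rV[R]_n} := HB.pack f (GRing.isLinear.Build _ _ _ _ f lf).
rewrite -[LHS]/(F u) [in LHS](row_sum_delta u) linear_sum.
by apply: eq_bigr => i _; rewrite linearZ.
Qed.

Lemma admx_linear : linear admx.
Proof.
by move=> a u v; rewrite /admx (linearP lmx) (linearP rmx) opprD addrACA -scalerBr.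
Qed.
HB.instance Definition _ := GRing.isLinear.Build R _ _ _ admx admx_linear.

Let trMl a (A B D : 'M[R]_n) : \tr ((a *: A + B) *m D) = a * \tr (A *m D) + \tr (B *m D).
Proof. by rewrite mulmxDl -scalemxAl mxtraceD mxtraceZ. Qed.

Let trMr a (A B D : 'M[R]_n) : \tr (D *m (a *: A + B)) = a * \tr (D *m A) + \tr (D *m B).
Proof. by rewrite mulmxDr -scalemxAr mxtraceD mxtraceZ. Qed.

Lemma ric_form_linearl c a u v : ric_form (a *: u + v) c = a * ric_form u c + ric_form v c.
Proof. by rewrite /ric_form (linearP admx) (linearP jmx) /= !trMl; ring. Qed.

Lemma ric_form_linearr b a u v : ric_form b (a *: u + v) = a * ric_form b u + ric_form b v.
Proof.
by rewrite /ric_form (linearP admx) (linearP jmx) /= (linearP adjoint) /= !trMr; ring.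
Qed.

(** The algebraic soliton condition: the Ricci operator is k plus a derivation, diagonal in the
    given basis. *)
Variables (k : R) (d : 'rV[R]_n).
Hypothesis C_der : forall i j l, C i j l != 0 -> d 0 l = d 0 i + d 0 j.
Hypothesis ric_form_delta : forall i j,
  ric_form (delta_mx 0 i) (delta_mx 0 j) = if i == j then w 0 i * (k + d 0 i) else 0.

Lemma ricci_frame_metric_diag x : ricci frame_metric x =
  coframe x *m (wmx *m (k%:M + diag_mx d)) *m (coframe x)^T.
Proof.
apply/matrixP => i j; rewrite ricci_frame_metric.
rewrite (scalar_sum_delta _ (ric_form_linearl _)) !mulmxA.
rewrite mul_mx_diag mulmxDr mul_mx_scalar.
rewrite mul_mx_diag [RHS]mxE; apply: eq_bigr => p _.
rewrite (scalar_sum_delta _ (ric_form_linearr _)) (bigD1 p) //= big1.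
  by rewrite addr0 ric_form_delta eqxx !mxE; ring.
by move=> q qp; rewrite ric_form_delta eq_sym (negbTE qp) mulr0.
Qed.

(** Half of the derivation, because the Lie derivative acts on both arguments of the metric. *)
Let E : 'M[R]_n := diag_mx (2^-1 *: d).

(** The derivation rule for (1 + x)^{-1} u, where E sends (1 + x)^{-1} to - (1 + x)^{-1} (E x) (1 +
    x)^{-1}. *)
Lemma coframe_der x : E *m coframe x - coframe x *m lmx (x *m E *m coframe x) = coframe x *m E.
Proof.
have xE l : (x *m E) 0 l = x 0 l * (2^-1 * d 0 l) by rewrite /E mul_mx_diag !mxE.
(* The derivation rule for (1 + x) u. *)
have key : frame x *m E - lmx (x *m E) = E *m frame x.
  rewrite /frame mulmxDl mulmxDr mul1mx mulmx1 -addrA; congr (_ + _).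
  apply/matrixP => i j; rewrite /lmx mulmx_suml mulmx_sumr -sumrB !summxE.
  apply: eq_bigr => l _; rewrite xE -scalemxAl -scalemxAr /E mul_mx_diag mul_diag_mx !mxE.
  have [->|/C_der ->] := eqVneq (C l i j) 0; first by rewrite !(mulr0, mul0r) subrr.
  ring.
apply: (can_inj (mulKmx (frame_unit x))); rewrite mulmxBr !mulmxA frameK !mul1mx.
by rewrite -lmx_coframe -mulmxBl key -mulmxA frameK mulmx1.
Qed.

(** The field x |-> E x generates automorphisms, so the Lie derivative of the metric is again
    left-invariant and is determined by its value at the unit. *)
Lemma frame_metric_soliton : ricci_soliton frame_metric.
Proof.
exists k, (fun x => x *m E); split=> [i|x].
  have -> : (fun x => (x *m E) 0 i) = fun x => x 0 i * E i i.
    by apply/funext => x; rewrite /E mul_mx_diag !mxE eqxx mulr1n.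
  by apply/poly_smooth/poly_mul; [exact: poly_coord|exact: poly_cst].
have dX i : partial_mx i (fun y => y *m E) x = row i E.
  rewrite partial_mxM; [|exact: poly_mx_id|exact: poly_mx_cst].
  by rewrite partial_mx_id partial_mx_cst mulmx0 addr0 rowE.
have -> : lie_derivative (fun x => x *m E) frame_metric x =
    \sum_l (x *m E) 0 l *: partial_mx l frame_metric x + E *m frame_metric x + frame_metric x *m E.
  apply/matrixP => i j; rewrite [LHS]mxE !big_split /= [RHS]mxE [X in _ = X + _]mxE summxE.
  congr (_ + _ + _).
  - by apply: eq_bigr => l _; rewrite partial_mxE [RHS]mxE.
  - rewrite [RHS]mxE; apply: eq_bigr => l _.
    by rewrite (partial_mxE i (fun y => y *m E)) dX [row _ _ _ _]mxE mulrC.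
  - rewrite [RHS]mxE; apply: eq_bigr => l _.
    rewrite (partial_mxE j (fun y => y *m E)) dX [row _ _ _ _]mxE.
    by rewrite /E ![diag_mx _ _ _]mxE eq_sym; case: eqP => [->|].
(* Along the field the metric has derivative - F - F^T. *)
set F := coframe x *m lmx (x *m E *m coframe x) *m wmx *m (coframe x)^T.
have -> : \sum_l (x *m E) 0 l *: partial_mx l frame_metric x = - F - F^T.
  have FE : F = \sum_l (x *m E) 0 l *: fmx l x.
    rewrite /F [_ *m coframe x]mulmx_sum_row (linear_sum lmx) /= mulmx_sumr !mulmx_suml.
    by apply: eq_bigr => l _; rewrite [lmx _]linearZ -scalemxAr -!scalemxAl.
  rewrite FE [(\sum_l _)^T]linear_sum /= -!sumrN -big_split; apply: eq_bigr => l _ /=.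
  by rewrite partial_frame_metric [(_ *: _)^T]linearZ /= -!scalerN scalerDr.
(* [coframe_der] absorbs F and moves E past the coframe. *)
have EG : E *m frame_metric x - F = coframe x *m E *m wmx *m (coframe x)^T.
  by rewrite -coframe_der /F /frame_metric !mulmxBl !mulmxA.
have -> : - F - F^T + E *m frame_metric x + frame_metric x *m E =
    (E *m frame_metric x - F) + (E *m frame_metric x - F)^T.
  rewrite [(_ - _)^T]linearB /= (trmx_mul E) trmx_frame_metric tr_diag_mx -/E.
  by rewrite [LHS](ACl (3*1*4*2)) addrA.
rewrite EG ricci_frame_metric_diag !trmx_mul trmxK trmx_wmx tr_diag_mx -/E.
rewrite mulmxDr mulmxDr mulmxDl mul_mx_scalar -scalemxAr -scalemxAl; congr (_ + _).
rewrite -!mulmxA -mulmxDr; congr (_ *m _); rewrite !mulmxA -mulmxDl; congr (_ *m _).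
(* E commutes with [wmx], so the two halves add up to [wmx *m diag_mx d]. *)
apply/matrixP => i j; rewrite /E /wmx !mul_diag_mx !mxE.
by case: eqP => [->|]; rewrite ?mulr0n ?mulr0 ?addr0 // !mulr1n; field.
Qed.

End GradedAlgebra.

(** * The path algebra as a graded algebra *)

Section PathAlgebra.
Context {R : realType} {Q : finite_quiver}.
Hypothesis Q_acyclic : acyclic Q.
Implicit Types (p q : seq (arrow Q)) (i j k l : 'I_(npath Q)) (u v x : 'rV[R]_(npath Q)).

Definition path_mx i : 'M[R]_(npath Q) :=
  \matrix_(j, k) (nth_path k == nth_path i ++ nth_path j)%:R.

Lemma path_mulE_lmx u v : path_mul u v = v *m lmx path_mx u.
Proof.
apply/rowP => k; rewrite path_mulE [RHS]mxE exchange_big; apply: eq_bigr => j _ /=.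
by rewrite /lmx summxE mulr_sumr; apply: eq_bigr => i _; rewrite !mxE; ring.
Qed.

Lemma nth_path_neq0 i : nth_path i != [::].
Proof. by case/andP: (nth_pathP i). Qed.

(** The grading is by length, and strict because vertices are not paths. *)
Lemma path_mx_graded i j k : path_mx i j k != 0 ->
  (size (nth_path i) < size (nth_path k))%N /\ (size (nth_path j) < size (nth_path k))%N.
Proof.
rewrite mxE; case: (nth_path k =P _) => [->|]; last by rewrite eqxx.
have := nth_path_neq0 i; have := nth_path_neq0 j; rewrite -!size_eq0 -!lt0n size_cat => j0 i0 _.
by rewrite -[X in (X < _)%N /\ _]addn0 -[X in _ /\ (X < _)%N]add0n ltn_add2l ltn_add2r.
Qed.

Lemma lmx_path_mxM u v :
  lmx path_mx (v *m lmx path_mx u) = lmx path_mx v *m lmx path_mx u.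
Proof.
apply/row_matrixP => i; rewrite row_mul !rowE -!path_mulE_lmx.
by rewrite -path_mulA.
Qed.

Lemma NQ_frame u x : frame path_mx (NQ_mul u x) = frame path_mx x *m frame path_mx u.
Proof.
rewrite /frame /NQ_mul path_mulE_lmx !(linearD (lmx path_mx)) /= lmx_path_mxM.
by rewrite mulmxDl !mulmxDr !mul1mx mulmx1 !addrA.
Qed.

Lemma diff_NQ_mul u x v : 'd (NQ_mul u) x v = v *m frame path_mx u.
Proof.
have -> : NQ_mul u = fun y => u + (y + path_mul u y).
  by apply/funext => y; rewrite /NQ_mul addrA.
rewrite (@diff_affine _ _ u (fun y => y + path_mul u y)).
  by rewrite path_mulE_lmx /frame mulmxDr mulmx1.
by move=> t y z; rewrite path_mulDr path_mulZr scalerDr addrACA.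
Qed.

Lemma frame_metric_left_invariant w : left_invariant_metric (@NQ_mul R Q) (frame_metric path_mx w).
Proof.
move=> a x u v; rewrite !diff_NQ_mul /metric_at /frame_metric.
(* Carrying a translated vector from the product of a and x back to the unit equals carrying the
   original back from x. *)
have E : frame path_mx a *m coframe path_mx (NQ_mul a x) = coframe path_mx x.
  rewrite -[LHS]mul1mx -(coframeK path_mx_graded x) -mulmxA [frame _ x *m _]mulmxA.
  by rewrite -NQ_frame (frameK path_mx_graded) mulmx1.
rewrite !trmx_mul !mulmxA -(mulmxA u) E.
by rewrite -(mulmxA _ (coframe _ _)^T) -trmx_mul E.
Qed.

(** * Endpoints of paths and consequences of acyclicity *)

Definition psource p : option (vertex Q) := omap (@source Q) (ohead p).
Definition ptarget p : option (vertex Q) :=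
  if p is a :: q then Some (target (last a q)) else None.

Lemma psource_cat p q : p != [::] -> psource (p ++ q) = psource p.
Proof. by case: p. Qed.

Lemma ptarget_cat p q : q != [::] -> ptarget (p ++ q) = ptarget q.
Proof. by case: p => [|a p]; case: q => [|b q] //= _; rewrite last_cat. Qed.

Lemma is_path_cat i j :
  is_path (nth_path i ++ nth_path j) = (ptarget (nth_path i) == psource (nth_path j)).
Proof.
have := nth_pathP i; have := nth_pathP j; rewrite /is_path.
case: (nth_path i) (nth_path j) => [//|a p] [//|b q] /= pj pi.
by rewrite cat_path pi /= pj andbT.
Qed.

Lemma psource_neq_ptarget i : psource (nth_path i) != ptarget (nth_path i).
Proof.
have := Q_acyclic (nth_path i); have := nth_pathP i.
by case: (nth_path i) => [//|a p] /= ->.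
Qed.

Lemma nth_path_cat_link i j k : nth_path k = nth_path i ++ nth_path j ->
  ptarget (nth_path i) = psource (nth_path j).
Proof. by move=> e; apply/eqP; rewrite -is_path_cat -e nth_pathP. Qed.

(** Both i and j begin k, so they share their source; as i ends where j starts, i would be a
    cycle. *)
Lemma nth_path_cat_noncomm i j i' k : nth_path k = nth_path i ++ nth_path j ->
  nth_path k = nth_path j ++ nth_path i' -> False.
Proof.
move=> e e'; move/eqP: (psource_neq_ptarget i); apply.
rewrite (nth_path_cat_link e) -(psource_cat (nth_path j) (nth_path_neq0 i)) -e e'.
by rewrite psource_cat ?nth_path_neq0.
Qed.

(** If both concatenations are paths, each is a cycle. *)
Lemma nth_path_cat_anti i j k l : nth_path k = nth_path i ++ nth_path j ->
  nth_path l = nth_path j ++ nth_path i -> False.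
Proof.
move=> e e'; move/eqP: (psource_neq_ptarget k); apply.
rewrite e psource_cat ?ptarget_cat ?nth_path_neq0 //.
by rewrite (nth_path_cat_link e').
Qed.

(** * Vertex weights and the derivation *)

Definition outdeg (v : option (vertex Q)) : nat := #|[pred i | psource (nth_path i) == v]|.
Definition indeg (v : option (vertex Q)) : nat := #|[pred i | ptarget (nth_path i) == v]|.

Definition vertex_weight (v : option (vertex Q)) : R := (1 + (outdeg v)%:R + (indeg v)%:R)^-1.

Lemma vertex_weight_gt0 (v : option (vertex Q)) : 0 < vertex_weight v.
Proof. by rewrite invr_gt0 -addrA ltr_wpDr ?addr_ge0 ?ler0n. Qed.

(** The interior vertices of a path are the sources of its arrows after the first, hence
    [behead]. *)
Definition path_weight : 'rV[R]_(npath Q) :=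
  \row_i \prod_(b <- behead (nth_path i)) vertex_weight (Some (source b)).

Definition path_ric : 'rV[R]_(npath Q) :=
  \row_i (2^-1 * (\sum_(b <- behead (nth_path i)) vertex_weight (Some (source b))
    - (outdeg (ptarget (nth_path i)))%:R * vertex_weight (ptarget (nth_path i))
    - (indeg (psource (nth_path i)))%:R * vertex_weight (psource (nth_path i)))).

Definition path_der : 'rV[R]_(npath Q) := path_ric + const_mx 2^-1.

Lemma path_weight_gt0 i : 0 < path_weight 0 i.
Proof. by rewrite mxE; apply: prodr_gt0 => b _; exact: vertex_weight_gt0. Qed.

(** Concatenation adds one interior vertex, the junction. The general monoid covers both the product
    in [path_weight] and the sum in [path_ric]. *)
Lemma big_behead_cat (T : Type) (idx : T) (op : Monoid.com_law idx)
    (F : option (vertex Q) -> T) i j :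
  \big[op/idx]_(b <- behead (nth_path i ++ nth_path j)) F (Some (source b)) =
  op (F (psource (nth_path j))) (op (\big[op/idx]_(b <- behead (nth_path i)) F (Some (source b)))
    (\big[op/idx]_(b <- behead (nth_path j)) F (Some (source b)))).
Proof.
have := nth_path_neq0 i; have := nth_path_neq0 j.
case: (nth_path i) (nth_path j) => [//|a p] [//|b q] /= _ _.
by rewrite big_cat big_cons /= Monoid.mulmCA.
Qed.

Lemma path_weight_cat i j k : nth_path k = nth_path i ++ nth_path j ->
  path_weight 0 k = vertex_weight (psource (nth_path j)) * (path_weight 0 i * path_weight 0 j).
Proof. by move=> e; rewrite !mxE e big_behead_cat. Qed.

(** Terms away from the junction v agree on both sides. At v what remains is that [vertex_weight v]
    times 1 + out(v) + in(v) is 1, which dictates the choice of the weights. *)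
Lemma path_der_cat i j k : path_mx i j k != 0 ->
  path_der 0 k = path_der 0 i + path_der 0 j.
Proof.
rewrite mxE; case: (nth_path k =P _) => [e|]; last by rewrite eqxx.
move=> _; rewrite !mxE e big_behead_cat psource_cat ?ptarget_cat ?nth_path_neq0 //.
rewrite (nth_path_cat_link e); set v := psource (nth_path j).
have : vertex_weight v * (1 + (outdeg v)%:R + (indeg v)%:R) = 1.
  by rewrite mulVf // gt_eqF // -invr_gt0 vertex_weight_gt0.
rewrite /=; move: (vertex_weight v) => av; nra.
Qed.

(** A splitting of k into two paths is a cut before one of its arrows after the first. *)
Lemma sum_splittings (F : option (vertex Q) -> R) k :
  \sum_i \sum_j path_mx i j k * F (psource (nth_path j)) =
  \sum_(b <- behead (nth_path k)) F (Some (source b)).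
Proof.
have := nth_pathP k; case pk: (nth_path k) => [//|a q] /=; rewrite /is_path /= => aq.
(* Cutting after n + 1 arrows, with n below [size q], leaves both parts nonempty. *)
have split_at (n : 'I_(size q)) : exists i j, nth_path i = take n.+1 (a :: q) /\
    nth_path j = drop n.+1 (a :: q).
  have [i ei] : exists i, nth_path i = take n.+1 (a :: q).
    by apply: is_pathP => //; rewrite /is_path take_sorted.
  have [j ej] : exists j, nth_path j = drop n.+1 (a :: q).
    apply: is_pathP => //; rewrite /is_path drop_sorted // andbT.
    by rewrite -size_eq0 size_drop subn_eq0 /= -ltnNge ltnS.
  by exists i, j.
(* Sorts the splittings by the length n + 1 of the first part. *)
transitivity (\sum_(n < size q) \sum_i \sum_j
    (path_mx i j k * (size (nth_path i) == n.+1)%:R) * F (psource (nth_path j))).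
  rewrite [RHS]exchange_big; apply: eq_bigr => i _; rewrite [RHS]exchange_big; apply: eq_bigr => j _ /=.
  rewrite -mulr_suml -mulr_sumr; case: (eqVneq (path_mx i j k) 0) => [->|]; first by rewrite !mul0r.
  rewrite mxE; case: (nth_path k =P _) => [e _|]; last by rewrite eqxx.
  have lt_i : ((size (nth_path i)).-1 < size q)%N.
    have := congr1 size e; rewrite pk size_cat /= => es.
    have := nth_path_neq0 i; have := nth_path_neq0 j; rewrite -!size_eq0.
    move: es; case: (size (nth_path i)) => [//|s] [->]; case: (size (nth_path j)) => [//|t] _ _ /=.
    by rewrite addnS ltnS leq_addr.
  have si : (size (nth_path i)).-1.+1 = size (nth_path i).
    by rewrite prednK // lt0n size_eq0 nth_path_neq0.
  rewrite (bigD1 (Ordinal lt_i)) //= si eqxx big1 ?addr0 ?mulr1 // => n ne.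
  case: eqP => // sn; case/eqP: ne; apply: val_inj => /=.
  by rewrite sn.
rewrite (big_nth a) big_mkord; apply: eq_bigr => n _.
have [i0 [j0 [ei ej]]] := split_at n.
have ek : nth_path k = nth_path i0 ++ nth_path j0 by rewrite ei ej cat_take_drop.
rewrite (bigD1 i0) //= (bigD1 j0) //= !big1 ?addr0.
- rewrite mxE ek eqxx ei size_takel; last by rewrite /= ltnS ltnW.
  rewrite eqxx !mul1r ej /psource /= (drop_nth a) //.
- move=> i ni; rewrite big1 // => j _; rewrite mxE; case: (nth_path k =P _) => [e|]; last by rewrite !mul0r.
  case: eqP => [si|]; last by rewrite mulr0 mul0r.
  case/eqP: ni; apply: nth_path_inj; rewrite ei -pk e -si.
  by rewrite take_size_cat.
- move=> j nj; rewrite mxE; case: (nth_path k =P _) => [e|]; last by rewrite !mul0r.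
  case/eqP: nj; apply: nth_path_inj; move: e; rewrite ek => /eqP.
  by rewrite eqseq_cat // eqxx /= => /eqP.
Qed.

(** * Orthogonality of the structure constants *)

Lemma path_mxP i j k :
  reflect (nth_path k = nth_path i ++ nth_path j) (path_mx i j k != 0).
Proof.
rewrite mxE; case: (nth_path k =P _) => [e|ne]; last by rewrite eqxx; constructor.
by rewrite oner_neq0; constructor.
Qed.

Lemma path_mx_sqr i j k : path_mx i j k * path_mx i j k = path_mx i j k.
Proof. by rewrite mxE; case: eqP; rewrite ?mulr1 ?mulr0. Qed.

Lemma path_mx_eq0 i j k : ~ (nth_path k = nth_path i ++ nth_path j) -> path_mx i j k = 0.
Proof. by move=> ne; apply/eqP/negPn/negP => /path_mxP. Qed.

(** Concatenation is cancellative, so in k = i j any two of the paths determine the third; this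
    gives the next two lemmas as well. *)
Lemma path_mx_orthol i i' j k :
  path_mx i j k * path_mx i' j k = (i == i')%:R * path_mx i j k.
Proof.
have [<-|ne] := eqVneq i i'; first by rewrite mul1r path_mx_sqr.
rewrite mul0r; case: (path_mxP i j k) => [e|/path_mx_eq0->]; last by rewrite mul0r.
rewrite [path_mx i' _ _]path_mx_eq0 ?mulr0 // => e'; case/eqP: ne; apply: nth_path_inj.
move: e'; rewrite e => c; have := congr1 size c; rewrite !size_cat => /addIn sz.
by move/eqP: c; rewrite eqseq_cat // => /andP[/eqP].
Qed.

Lemma path_mx_orthor i j j' k :
  path_mx i j k * path_mx i j' k = (j == j')%:R * path_mx i j k.
Proof.
have [<-|ne] := eqVneq j j'; first by rewrite mul1r path_mx_sqr.
rewrite mul0r; case: (path_mxP i j k) => [e|/path_mx_eq0->]; last by rewrite mul0r.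
rewrite [path_mx _ j' _]path_mx_eq0 ?mulr0 // => e'; case/eqP: ne; apply: nth_path_inj.
by move: e'; rewrite e => /eqP; rewrite eqseq_cat // eqxx => /eqP.
Qed.

Lemma path_mx_orthok i j k k' :
  path_mx i j k * path_mx i j k' = (k == k')%:R * path_mx i j k.
Proof.
have [<-|ne] := eqVneq k k'; first by rewrite mul1r path_mx_sqr.
rewrite mul0r; case: (path_mxP i j k) => [e|/path_mx_eq0->]; last by rewrite mul0r.
rewrite [path_mx _ _ k']path_mx_eq0 ?mulr0 // => e'; case/eqP: ne; apply: nth_path_inj.
by rewrite e e'.
Qed.

(** With [path_mx_anti], this removes the mixed terms when products of commutator coefficients are
    expanded. *)
Lemma path_mx_noncomm i j i' k : path_mx i j k * path_mx j i' k = 0.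
Proof.
case: (path_mxP i j k) => [e|/path_mx_eq0->]; last by rewrite mul0r.
by rewrite [path_mx j _ _]path_mx_eq0 ?mulr0 // => /(nth_path_cat_noncomm e).
Qed.

Lemma path_mx_anti i j k l : path_mx i j k * path_mx j i l = 0.
Proof.
case: (path_mxP i j k) => [e|/path_mx_eq0->]; last by rewrite mul0r.
by rewrite [path_mx j _ _]path_mx_eq0 ?mulr0 // => /(nth_path_cat_anti e).
Qed.

Lemma sum_path_mx i j :
  \sum_k path_mx i j k = (ptarget (nth_path i) == psource (nth_path j))%:R.
Proof.
rewrite -is_path_cat; case: (boolP (is_path _)) => [/(is_pathP Q_acyclic)[k e]|np].
  rewrite (bigD1 k) //= big1 => [|l ne]; first by rewrite mxE e eqxx addr0.
  by apply: path_mx_eq0 => e'; case/eqP: ne; apply: nth_path_inj; rewrite e' e.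
rewrite big1 // => k _; apply: path_mx_eq0 => e.
by case/negP: np; rewrite -e nth_pathP.
Qed.

(** The factor [path_mx i j k] carries the condition that k is the concatenation, so this and
    [path_mx_link] rewrite without case analysis. *)
Lemma path_weight_path_mx i j k : path_weight 0 k * path_mx i j k =
  vertex_weight (psource (nth_path j)) * (path_weight 0 i * path_weight 0 j) * path_mx i j k.
Proof.
case: (path_mxP i j k) => [/path_weight_cat->//|/path_mx_eq0->]; by rewrite !mulr0.
Qed.

Lemma path_mx_link (F : option (vertex Q) -> R) i j k :
  F (psource (nth_path j)) * path_mx i j k = F (ptarget (nth_path i)) * path_mx i j k.
Proof.
case: (path_mxP i j k) => [/nth_path_cat_link->//|/path_mx_eq0->]; by rewrite !mulr0.
Qed.

(** * Traces in the path basis and the Ricci eigenvalues *)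

Local Notation w := path_weight.

Lemma admx_path i a b : admx path_mx (delta_mx 0 i) a b = path_mx i a b - path_mx a i b.
Proof.
by rewrite /admx lmx_delta mxE [(- _ : 'M_ _) a b]mxE [rmx _ _ _ _]mxE -rowE [row _ _ _ _]mxE.
Qed.

Lemma bmx_path i a b : bmx path_mx w (delta_mx 0 i) a b = path_mx a b i * w 0 i.
Proof.
by rewrite [LHS]mxE trmx_delta -colE mxE /wmx mul_mx_diag mxE.
Qed.

Lemma jmx_path i a b : jmx path_mx w (delta_mx 0 i) a b =
  (path_mx b a i - path_mx a b i) * w 0 i / w 0 b.
Proof.
rewrite /jmx /wmx_inv mul_mx_diag mxE [map_mx _ _ _ _]mxE; congr (_ * _).
by rewrite mulrBl -!bmx_path [LHS]mxE [(_^T) _ _]mxE [(- _ : 'M_ _) a b]mxE.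
Qed.

Lemma mxtrace_mul_adjoint n (v : 'rV[R]_n) (A B : 'M[R]_n) :
  \tr (A *m adjoint v B) = \sum_a \sum_b v 0 b / v 0 a * (A a b * B a b).
Proof.
apply: eq_bigr => a _; rewrite mxE; apply: eq_bigr => b _.
by rewrite /adjoint /wmx /wmx_inv mul_mx_diag mul_diag_mx !mxE; ring.
Qed.

Lemma path_weight_neq0 i : w 0 i != 0.
Proof. by rewrite gt_eqF // path_weight_gt0. Qed.

(** For p = [nth_path i] and each q starting at t(p), the ratio |pq|^2 / |q|^2 is a(t(p)) |p|^2
    whatever q is, so the sum only counts such q; likewise for products q p. *)
Lemma mxtrace_admx_path i j :
  \tr (admx path_mx (delta_mx 0 i) *m adjoint w (admx path_mx (delta_mx 0 j))) =
  (i == j)%:R * (w 0 i *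
    ((outdeg (ptarget (nth_path i)))%:R * vertex_weight (ptarget (nth_path i)) +
     (indeg (psource (nth_path i)))%:R * vertex_weight (psource (nth_path i)))).
Proof.
rewrite mxtrace_mul_adjoint; set t := ptarget _; set s := psource _.
transitivity (\sum_a \sum_b (i == j)%:R * (w 0 i *
    (vertex_weight t * path_mx i a b + vertex_weight s * path_mx a i b))).
  apply: eq_bigr => a _; apply: eq_bigr => b _; rewrite !admx_path.
  have -> : (path_mx i a b - path_mx a i b) * (path_mx j a b - path_mx a j b) =
      (i == j)%:R * (path_mx i a b + path_mx a i b).
    rewrite mulrBl !mulrBr path_mx_orthol path_mx_orthor path_mx_noncomm.
    by rewrite [path_mx a i b * _]mulrC path_mx_noncomm; ring.
  rewrite -(path_mx_link vertex_weight).
  transitivity ((i == j)%:R * (w 0 b * path_mx i a b + w 0 b * path_mx a i b) / w 0 a).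
    by ring.
  by rewrite !path_weight_path_mx; field; exact: path_weight_neq0.
have outE : (outdeg t)%:R = \sum_a (t == psource (nth_path a))%:R :> R.
  rewrite /outdeg -sum1_card natr_sum big_mkcond; apply: eq_bigr => a _.
  by rewrite inE eq_sym; case: eqP.
have inE' : (indeg s)%:R = \sum_a (ptarget (nth_path a) == s)%:R :> R.
  rewrite /indeg -sum1_card natr_sum big_mkcond; apply: eq_bigr => a _.
  by rewrite inE; case: eqP.
under eq_bigr do rewrite -!mulr_sumr big_split /= -!mulr_sumr !sum_path_mx.
by rewrite -!mulr_sumr big_split /= -!mulr_sumr -outE -inE' ![vertex_weight _ * _]mulrC.
Qed.

(** Each cut of a path p into c and e contributes |p|^2 / (|c|^2 |e|^2) times |p|^2, that is |p|^2
    times the weight at the junction. It occurs in both orders, and the sign is that of a skew map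
    squared. *)
Lemma mxtrace_jmx_path i j :
  \tr (jmx path_mx w (delta_mx 0 i) *m jmx path_mx w (delta_mx 0 j)) =
  - (i == j)%:R * (w 0 i * (2 * \sum_(b <- behead (nth_path i)) vertex_weight (Some (source b)))).
Proof.
transitivity (\sum_a \sum_b - (i == j)%:R * (w 0 i *
    (path_mx a b i * vertex_weight (psource (nth_path b)) +
     path_mx b a i * vertex_weight (psource (nth_path a))))).
  apply: eq_bigr => a _; rewrite mxE; apply: eq_bigr => b _; rewrite !jmx_path.
  have E : (path_mx b a i - path_mx a b i) * (path_mx a b j - path_mx b a j) =
      - (i == j)%:R * (path_mx a b i + path_mx b a i).
    rewrite mulrBl !mulrBr !path_mx_orthok path_mx_anti.
    by rewrite path_mx_anti; ring.
  have wE c e : w 0 i * path_mx c e i / w 0 c / w 0 e =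
      path_mx c e i * vertex_weight (psource (nth_path e)).
    by rewrite path_weight_path_mx; field; rewrite !path_weight_neq0.
  rewrite -!wE.
  transitivity ((path_mx b a i - path_mx a b i) * (path_mx a b j - path_mx b a j)
     * (w 0 i * w 0 j) / w 0 a / w 0 b); first by ring.
  rewrite E; have [<-|ne] := eqVneq i j; last by rewrite oppr0 !mul0r.
  ring.
have S1 : \sum_a \sum_b path_mx a b i * vertex_weight (psource (nth_path b)) =
  \sum_(b <- behead (nth_path i)) vertex_weight (Some (source b)) by exact: sum_splittings.
under eq_bigr do rewrite -!mulr_sumr big_split /=.
rewrite -!mulr_sumr big_split /= S1.
by rewrite [X in _ + X]exchange_big /= S1; ring.
Qed.

Lemma ric_form_path i j : ric_form path_mx path_weight (delta_mx 0 i) (delta_mx 0 j) =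
  if i == j then path_weight 0 i * (- 2^-1 + path_der 0 i) else 0.
Proof.
rewrite /ric_form mxtrace_admx_path mxtrace_jmx_path.
have [_|ne] := eqVneq i j; last by rewrite oppr0 !mul0r !mulr0 subr0.
rewrite /path_der; move: (w 0 i) => wi; rewrite !mxE.
move: (_ * vertex_weight _) (_ * vertex_weight _) (\sum_(b <- _) _) => x y z; rewrite mulr1n; lra.
Qed.

End PathAlgebra
.

Theorem theorem1p1 (R : realType) (Q : finite_quiver) (Q_acyclic : acyclic Q) :
  exists g : 'rV[R]_(npath Q) -> 'M[R]_(npath Q),
    [/\ riemannian_metric g,
        left_invariant_metric (@NQ_mul R Q) g &
        ricci_soliton g].
Proof.
have gr := @path_mx_graded R Q; have A := @lmx_path_mxM R Q Q_acyclic.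
exists (frame_metric (@path_mx R Q) (@path_weight R Q)); split.
- exact: (frame_metric_riemannian gr path_weight_gt0).
- exact: frame_metric_left_invariant.
(* Unification takes -1/2 for k and [path_der] for d. *)
- exact: (frame_metric_soliton gr A path_weight_gt0 path_der_cat (ric_form_path Q_acyclic)).
Qed.
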